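(* Let $L:\mathcal{Z}\times\mathcal{A}\to(-\infty,\infty]$ be a loss function with domain $\mathcal{P}$, with Bayes acts $a(P)$ and Bayes loss $H(P)$, $P\in\mathcal{P}$. Define, for $z\in\mathcal{Z}$ and $Q\in\mathcal{P}$, $$S(z,Q):=L\{z,a(Q)\},\qquad S(P,Q):=E_P\{S(Z,Q)\}.$$ Then $S$ is a proper scoring rule over $\mathcal{P}$, and $S(P,P)=H(P)$ for all $P\in\mathcal{P}$. If moreover $L$ is strict, then $S$ is strictly proper.
   Context: $\mathcal{Z}$ is the (measurable) space of values of an uncertain quantity $Z$ and $\mathcal{A}$ is an action space. $\mathcal{P}$ is a family of probability distributions on $\mathcal{Z}$ that is convex in the sense that $E(\tilde P)\in\mathcal{P}$ for every random element $\tilde P$ of $\mathcal{P}$ (where $E(\tilde P)$ is the mixture distribution). For $P\in\mathcal{P}$, $a\in\mathcal{A}$ put $L(P,a):=E_P\{L(Z,a)\}$. That $L$ has domain $\mathcal{P}$ means: for all $P\in\mathcal{P}$, $a\in\mathcal{A}$, $L(P,a)$ exists (possibly infinite); the Bayes loss $H(P):=\inf_{a\in\mathcal{A}}L(P,a)$ is finite for every $P\in\mathcal{P}$; and the infimum is attained at some (not necessarily unique) Bayes act $a(P)\in\mathcal{A}$, a particular choice of which is fixed for each $P$. $L$ is strict if, for $P,Q\in\mathcal{P}$ with $P\neq Q$, Bayes acts under $P$ and under $Q$ are necessarily different (no act is Bayes for both). A scoring rule $S(z,Q)$ ($z\in\mathcal{Z}$, $Q\in\mathcal{P}$) is proper over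 $\mathcal{P}$ if $S(P,P)$ is finite and $S(P,P)\le S(P,Q)$ for all $P,Q\in\mathcal{P}$; it is strictly proper if the inequality is strict whenever $Q\ne P$. *)

(* Defs.v *)
From mathcomp Require Import all_boot all_order all_algebra.
From mathcomp Require Import all_classical all_reals all_analysis.
From mathcomp Require Import measurable_realfun giry.

Set Implicit Arguments.
Unset Strict Implicit.
Unset Printing Implicit Defensive.

Import Order.TTheory GRing.Theory Num.Theory.

Local Open Scope classical_set_scope.
Local Open Scope ring_scope.
Local Open Scope ereal_scope.

(* A term of type [probability Z R] also carries values on the non-measurable
   subsets of Z, so one distribution may have several representatives.
   Throughout, equality of distributions is therefore [P ≡μ Q] (agreement on the
   measurable sets) and never Leibniz equality. A family of distributions is a
   set of representatives, in which representatives may be repeated. *)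

(* [Q] is the mixture E(X) of the random distribution [X] under [mu]. *)
Definition is_mixture d d' (W : measurableType d') (Z : measurableType d)
    (R : realType) (mu : probability W R) (X : W -> pprobability Z R)
    (Q : probability Z R) : Prop :=
  forall B, measurable B ->
    Q B = \int[mu]_w (X w : probability Z R) B.

(* The sigma-algebra of [pprobability Z R] is generated by the evaluations at
   measurable sets, so that [X] below is a random element of [F]. *)
Definition convex_family d (Z : measurableType d) (R : realType)
    (F : set (probability Z R)) : Prop :=
  forall d' (W : measurableType d') (mu : probability W R)
      (X : W -> pprobability Z R),
    measurable_fun [set: W] X -> (forall w, F (X w)) ->
    exists2 Q, F Q & is_mixture mu X Q.

(* The Lebesgue integral is a total function; this says that E_P(f) is
   meaningful, as an element of [-oo, +oo]: its defining difference
   is not +oo - +oo. *)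
Definition has_expectation d (Z : measurableType d) (R : realType)
    (P : probability Z R) (f : Z -> \bar R) : Prop :=
  measurable_fun [set: Z] f /\
  (\int[P]_z (f ^\+)%E z) +? - (\int[P]_z (f ^\-)%E z).

Section loss.
Context d (Z : measurableType d) (R : realType) (A : Type).
Implicit Types (L : Z -> A -> \bar R) (P Q : probability Z R) (a b : A).

(* L(P, a); for a scoring rule, where the acts are distributions, it is
   S(P, Q). *)
Definition expected_loss L P a : \bar R := \int[P]_z L z a.

Definition bayes_loss L P : \bar R :=
  ereal_inf (range (expected_loss L P)).

Definition bayes_act L P a : Prop := expected_loss L P a = bayes_loss L P.

Definition has_domain L (F : set (probability Z R)) : Prop :=
  forall P, F P ->
    [/\ forall a, has_expectation P (L ^~ a),
        bayes_loss L P \is a fin_num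
      & exists a, bayes_act L P a].

Definition strict_loss L (F : set (probability Z R)) : Prop :=
  forall P Q, F P -> F Q -> ~ (P ≡μ Q) ->
    forall a b, bayes_act L P a -> bayes_act L Q b -> a <> b.

End loss.

Section scoring_rule.
Context d (Z : measurableType d) (R : realType).
Implicit Types (S : Z -> probability Z R -> \bar R)
  (F : set (probability Z R)).

(* The first clause makes explicit that the expected scores being compared
   exist. *)
Definition proper_score S F : Prop :=
  [/\ forall P Q, F P -> F Q -> has_expectation P (S ^~ Q),
      forall P, F P -> expected_loss S P P \is a fin_num
    & forall P Q, F P -> F Q -> expected_loss S P P <= expected_loss S P Q].

Definition strictly_proper_score S F : Prop :=
  proper_score S F /\
  forall P Q, F P -> F Q -> ~ (Q ≡μ P) ->
    expected_loss S P P < expected_loss S P Q.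

End scoring_rule.

(* Main.v *)
Require Import Defs.
From mathcomp Require Import all_boot all_order all_algebra.
From mathcomp Require Import all_classical all_reals all_analysis.

(** The score of the forecast [Q] is the loss incurred by acting as if [Q] were
    true, so that [S(P, Q) = L(P, a(Q))]. Since [a(P)] minimizes [L(P, .)], the
    honest forecast [Q = P] minimizes [S(P, .)], with minimum the Bayes loss
    [H(P)]. If another forecast [Q] also attained [H(P)], then the act [a(Q)]
    would be Bayes under both [P] and [Q], which a strict loss excludes. *)

Local Open Scope classical_set_scope.
Local Open Scope ring_scope.
Local Open Scope ereal_scope.

Lemma bayes_loss_le d (Z : measurableType d) (R : realType) (A : Type)
    (L : Z -> A -> \bar R) (P : probability Z R) (b : A) :
  bayes_loss L P <= expected_loss L P b.
Proof. by apply: ereal_inf_lbound; exists b. Qed.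

Theorem mainTheorem1 (R : realType) (d : measure_display)
    (Z : measurableType d) (A : Type)
    (F : set (probability Z R)) (L : Z -> A -> \bar R)
    (a : probability Z R -> A)
    (F_convex : convex_family F)
    (L_gtNy : forall z b, -oo < L z b)
    (L_domain : has_domain L F)
    (a_bayes : forall P, F P -> bayes_act L P (a P)) :
  let S := fun (z : Z) (Q : probability Z R) => L z (a Q) in
  [/\ proper_score S F,
      forall P, F P -> expected_loss S P P = bayes_loss L P
    & strict_loss L F -> strictly_proper_score S F].
Proof.
move=> S.
have honestE P : F P -> expected_loss S P P = bayes_loss L P by exact: a_bayes.
have S_proper : proper_score S F.
  split=> [P Q FP _|P FP|P Q FP _].
  - by have [Lexp _ _] := L_domain P FP; exact: Lexp.
  - by rewrite honestE //; have [] := L_domain P FP.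
  - by rewrite honestE //; exact: bayes_loss_le.
split=> // L_strict; split=> // P Q FP FQ neqQP.
rewrite honestE // Order.POrderTheory.lt_neqAle bayes_loss_le andbT.
apply/eqP => tie.
have aQ_bayes : bayes_act L P (a Q) by exact/esym.
exact: (L_strict Q P FQ FP neqQP (a Q) (a Q) (a_bayes Q FQ) aQ_bayes).
Qed.
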